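(* Every s-hypersequent that is provable in the logic $\mathbf{PDBL}$ is valid in the class of all pure double Boolean algebras.
   Context: Pure double Boolean algebras. A double Boolean algebra (dBa) is an algebra $\mathbf{D}=(D,\sqcup,\sqcap,\neg,\lrcorner,\top,\bot)$ (binary $\sqcup,\sqcap$, unary $\neg,\lrcorner$, constants $\top,\bot$) such that, writing $x\vee y:=\neg(\neg x\sqcap\neg y)$ and $x\wedge y:=\lrcorner(\lrcorner x\sqcup\lrcorner y)$, for all $x,y,z\in D$: $(x\sqcap x)\sqcap y=x\sqcap y$; $(x\sqcup x)\sqcup y=x\sqcup y$; $\sqcap$ and $\sqcup$ are commutative and associative; $\neg(x\sqcap x)=\neg x$; $\lrcorner(x\sqcup x)=\lrcorner x$; $x\sqcap(x\sqcup y)=x\sqcap x$; $x\sqcup(x\sqcap y)=x\sqcup x$; $x\sqcap(y\vee z)=(x\sqcap y)\vee(x\sqcap z)$; $x\sqcup(y\wedge z)=(x\sqcup y)\wedge(x\sqcup z)$; $x\sqcap(x\vee y)=x\sqcap x$; $x\sqcup(x\wedge y)=x\sqcup x$; $\neg\neg(x\sqcap y)=x\sqcap y$; $\lrcorner\lrcorner(x\sqcup y)=x\sqcup y$; $x\sqcap\neg x=\bot$; $x\sqcup\lrcorner x=\top$; $\neg\bot=\top\sqcap\top$; $\lrcorner\top=\bot\sqcup\bot$; $\neg\top=\bot$; $\lrcorner\bot=\top$; $(x\sqcap x)\sqcup(x\sqcap x)=(x\sqcup x)\sqcap(x\sqcup x)$. It is pure (a pdBa) if for every $x\in D$, $x\sqcap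 x=x$ or $x\sqcup x=x$. Put $D_\sqcap=\{x:x\sqcap x=x\}$, $D_\sqcup=\{x:x\sqcup x=x\}$, and $x\sqsubseteq y$ iff $x\sqcap y=x\sqcap x$ and $x\sqcup y=y\sqcup y$. The logic PDBL. The language has two disjoint countably infinite sets of variables, object variables $\mathbf{OV}$ ($p,q,\dots$) and property variables $\mathbf{PV}$ ($P,Q,\dots$), constants $\top,\bot$, binary connectives $\sqcap,\sqcup$ and unary connectives $\neg,\lrcorner$; formulae: $\top\mid\bot\mid p\mid P\mid\alpha\sqcup\beta\mid\alpha\sqcap\beta\mid\neg\alpha\mid\lrcorner\alpha$. Abbreviations: $\alpha\vee\beta:=\neg(\neg\alpha\sqcap\neg\beta)$, $\alpha\wedge\beta:=\lrcorner(\lrcorner\alpha\sqcup\lrcorner\beta)$. A sequent is a pair of formulae written $\alpha\vdash\beta$; $\alpha\dashv\vdash\beta$ abbreviates the two sequents $\alpha\vdash\beta$, $\beta\vdash\alpha$. An s-hypersequent is a finite sequence $\alpha_1\vdash\beta_1\mid\dots\mid\alpha_n\vdash\beta_n$ of sequents (its components); $B,C,D,E,F,G,H,X$ range over possibly empty s-hypersequents. Axioms (for all formulae $\alpha,\beta,\gamma$, $p\in\mathbf{OV}$, $P\in\mathbf{PV}$): $\alpha\vdash\alpha$; $\alpha\sqcap\beta\vdash\alpha$; $\alpha\sqcap\beta\vdash\beta$; $\alpha\vdash\alpha\sqcup\beta$; $\beta\vdash\alpha\sqcup\beta$; $\alpha\sqcap\beta\vdash(\alpha\sqcap\beta)\sqcap(\alpha\sqcap\beta)$;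 $(\alpha\sqcup\beta)\sqcup(\alpha\sqcup\beta)\vdash\alpha\sqcup\beta$; $\neg(\alpha\sqcap\alpha)\vdash\neg\alpha$; $\lrcorner\alpha\vdash\lrcorner(\alpha\sqcup\alpha)$; $\alpha\sqcap\neg\alpha\vdash\bot$; $\top\vdash\alpha\sqcup\lrcorner\alpha$; $\neg\neg(\alpha\sqcap\beta)\dashv\vdash\alpha\sqcap\beta$; $\lrcorner\lrcorner(\alpha\sqcup\beta)\dashv\vdash\alpha\sqcup\beta$; $\alpha\sqcap\alpha\vdash\alpha\sqcap(\alpha\sqcup\beta)$; $\alpha\sqcup(\alpha\sqcap\beta)\vdash\alpha\sqcup\alpha$; $\alpha\sqcap\alpha\vdash\alpha\sqcap(\alpha\vee\beta)$; $\alpha\sqcup(\alpha\wedge\beta)\vdash\alpha\sqcup\alpha$; $\alpha\sqcap(\beta\vee\gamma)\dashv\vdash(\alpha\sqcap\beta)\vee(\alpha\sqcap\gamma)$; $\alpha\sqcup(\beta\wedge\gamma)\dashv\vdash(\alpha\sqcup\beta)\wedge(\alpha\sqcup\gamma)$; $\bot\vdash\alpha$; $\alpha\vdash\top$; $\neg\top\vdash\bot$; $\top\vdash\lrcorner\bot$; $\neg\bot\dashv\vdash\top\sqcap\top$; $\lrcorner\top\dashv\vdash\bot\sqcup\bot$; $(\alpha\sqcup\alpha)\sqcap(\alpha\sqcup\alpha)\dashv\vdash(\alpha\sqcap\alpha)\sqcup(\alpha\sqcap\alpha)$; $p\sqcap p\dashv\vdash p$; $P\sqcup P\dashv\vdash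 P$; and (Sp) the s-hypersequent $\alpha\vdash\alpha\sqcap\alpha\mid\alpha\sqcup\alpha\vdash\alpha$. Rules: from $B\mid\alpha\vdash\beta\mid C$ infer each of $B\mid\alpha\sqcap\gamma\vdash\beta\sqcap\gamma\mid C$, $B\mid\gamma\sqcap\alpha\vdash\gamma\sqcap\beta\mid C$, $B\mid\alpha\sqcup\gamma\vdash\beta\sqcup\gamma\mid C$, $B\mid\gamma\sqcup\alpha\vdash\gamma\sqcup\beta\mid C$, $B\mid\neg\beta\vdash\neg\alpha\mid C$, $B\mid\lrcorner\beta\vdash\lrcorner\alpha\mid C$; from $B\mid\alpha\vdash\beta\mid C$ and $D\mid\beta\vdash\gamma\mid E$ infer $B\mid D\mid\alpha\vdash\gamma\mid C\mid E$; from $B\mid\alpha\sqcap\beta\vdash\alpha\sqcap\alpha\mid C$, $D\mid\alpha\sqcap\alpha\vdash\alpha\sqcap\beta\mid E$, $F\mid\alpha\sqcup\beta\vdash\beta\sqcup\beta\mid G$, $H\mid\beta\sqcup\beta\vdash\alpha\sqcup\beta\mid X$ infer $B\mid D\mid F\mid H\mid\alpha\vdash\beta\mid C\mid E\mid G\mid X$; external rules: from $B\mid D\mid D\mid C$ infer $B\mid D\mid C$; from $B\mid D\mid E\mid C$ infer $B\mid E\mid D\mid C$; from $B$ infer $B\mid C$. An s-hypersequent is provable if it is the last member of a finite sequence each member of which is an axiom or follows from earlier members by a rule. Algebraic semantics. A valuation on a pdBa $\mathbf{D}$ is a map $v$ on $\mathbf{OV}\cup\mathbf{PV}\cup\{\top,\bot\}$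 with $v(p)\in D_\sqcap$ for $p\in\mathbf{OV}$, $v(P)\in D_\sqcup$ for $P\in\mathbf{PV}$, $v(\top)=\top$, $v(\bot)=\bot$, extended to all formulae homomorphically ($v(\alpha\sqcap\beta)=v(\alpha)\sqcap v(\beta)$, etc.). $v$ satisfies $\alpha\vdash\beta$ iff $v(\alpha)\sqsubseteq v(\beta)$, and satisfies an s-hypersequent iff it satisfies one of its components. An s-hypersequent is true in $\mathbf{D}$ if every valuation on $\mathbf{D}$ satisfies it, and valid in the class of pdBas if true in every pdBa. *)

(* Defs.v *)
From Stdlib Require Import List.
Import ListNotations.

Set Implicit Arguments.
Unset Strict Implicit.
Unset Printing Implicit Defensive.

Reserved Notation "x ⊓ y" (at level 50, no associativity).
Reserved Notation "x ⊔ y" (at level 50, no associativity).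
Reserved Notation "x ∨ y" (at level 50, no associativity).
Reserved Notation "x ∧ y" (at level 50, no associativity).
Reserved Notation "¬ x" (at level 35, right associativity).
Reserved Notation "⌟ x" (at level 35, right associativity).
Reserved Notation "x ⊑ y" (at level 70, no associativity).
Reserved Notation "a ⊢ b" (at level 70, no associativity).

Record dba_sig : Type := DbaSig {
  carrier :> Type;
  join : carrier -> carrier -> carrier;
  meet : carrier -> carrier -> carrier;
  neg : carrier -> carrier;
  opp : carrier -> carrier;
  top : carrier;
  bot : carrier
}.

Arguments join {_}.
Arguments meet {_}.
Arguments neg {_}.
Arguments opp {_}.
Arguments top {_}.
Arguments bot {_}.

Declare Scope dba_scope.
Delimit Scope dba_scope with dba.
Bind Scope dba_scope with carrier.

Notation "x ⊔ y" := (join x y) : dba_scope.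
Notation "x ⊓ y" := (meet x y) : dba_scope.
Notation "¬ x" := (neg x) : dba_scope.
Notation "⌟ x" := (opp x) : dba_scope.
Notation "⊤" := top : dba_scope.
Notation "⊥" := bot : dba_scope.

Local Open Scope dba_scope.

Definition vee (D : dba_sig) (x y : D) : D := ¬ (¬ x ⊓ ¬ y).
Definition wedge (D : dba_sig) (x y : D) : D := ⌟ (⌟ x ⊔ ⌟ y).

Notation "x ∨ y" := (vee x y) : dba_scope.
Notation "x ∧ y" := (wedge x y) : dba_scope.

Record is_dba (D : dba_sig) : Prop := IsDba {
  meet_idl : forall x y : D, (x ⊓ x) ⊓ y = x ⊓ y;
  join_idl : forall x y : D, (x ⊔ x) ⊔ y = x ⊔ y;
  meet_comm : forall x y : D, x ⊓ y = y ⊓ x;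
  join_comm : forall x y : D, x ⊔ y = y ⊔ x;
  meet_assoc : forall x y z : D, x ⊓ (y ⊓ z) = (x ⊓ y) ⊓ z;
  join_assoc : forall x y z : D, x ⊔ (y ⊔ z) = (x ⊔ y) ⊔ z;
  neg_meet_id : forall x : D, ¬ (x ⊓ x) = ¬ x;
  opp_join_id : forall x : D, ⌟ (x ⊔ x) = ⌟ x;
  meet_join_absorb : forall x y : D, x ⊓ (x ⊔ y) = x ⊓ x;
  join_meet_absorb : forall x y : D, x ⊔ (x ⊓ y) = x ⊔ x;
  meet_vee_distr : forall x y z : D, x ⊓ (y ∨ z) = (x ⊓ y) ∨ (x ⊓ z);
  join_wedge_distr : forall x y z : D, x ⊔ (y ∧ z) = (x ⊔ y) ∧ (x ⊔ z);
  meet_vee_absorb : forall x y : D, x ⊓ (x ∨ y) = x ⊓ x;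
  join_wedge_absorb : forall x y : D, x ⊔ (x ∧ y) = x ⊔ x;
  neg_neg_meet : forall x y : D, ¬ ¬ (x ⊓ y) = x ⊓ y;
  opp_opp_join : forall x y : D, ⌟ ⌟ (x ⊔ y) = x ⊔ y;
  meet_neg : forall x : D, x ⊓ ¬ x = ⊥;
  join_opp : forall x : D, x ⊔ ⌟ x = ⊤;
  neg_bot : ¬ ⊥ = ⊤ ⊓ ⊤ :> D;
  opp_top : ⌟ ⊤ = ⊥ ⊔ ⊥ :> D;
  neg_top : ¬ ⊤ = ⊥ :> D;
  opp_bot : ⌟ ⊥ = ⊤ :> D;
  meet_join_id : forall x : D, (x ⊓ x) ⊔ (x ⊓ x) = (x ⊔ x) ⊓ (x ⊔ x)
}.

Definition in_meet_part (D : dba_sig) (x : D) : Prop := x ⊓ x = x.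
Definition in_join_part (D : dba_sig) (x : D) : Prop := x ⊔ x = x.

Definition is_pure (D : dba_sig) : Prop :=
  forall x : D, in_meet_part x \/ in_join_part x.

Definition is_pdba (D : dba_sig) : Prop := is_dba D /\ is_pure D.

Definition sqle (D : dba_sig) (x y : D) : Prop :=
  x ⊓ y = x ⊓ x /\ x ⊔ y = y ⊔ y.

Notation "x ⊑ y" := (sqle x y) : dba_scope.

Local Close Scope dba_scope.

(* [FOVar] and [FPVar] tag the two disjoint countably infinite sets of
   object variables and property variables. *)
Inductive formula : Type :=
| FTop
| FBot
| FOVar (n : nat)
| FPVar (n : nat)
| FJoin (a b : formula)
| FMeet (a b : formula)
| FNeg (a : formula)
| FOpp (a : formula).

Definition FVee (a b : formula) : formula := FNeg (FMeet (FNeg a) (FNeg b)).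
Definition FWedge (a b : formula) : formula := FOpp (FJoin (FOpp a) (FOpp b)).

Definition sequent : Type := (formula * formula)%type.
Definition hypersequent : Type := list sequent.

Declare Scope formula_scope.
Delimit Scope formula_scope with formula.
Bind Scope formula_scope with formula.

Notation "a ⊔ b" := (FJoin a b) : formula_scope.
Notation "a ⊓ b" := (FMeet a b) : formula_scope.
Notation "¬ a" := (FNeg a) : formula_scope.
Notation "⌟ a" := (FOpp a) : formula_scope.
Notation "⊤" := FTop : formula_scope.
Notation "⊥" := FBot : formula_scope.
Notation "a ∨ b" := (FVee a b) : formula_scope.
Notation "a ∧ b" := (FWedge a b) : formula_scope.
Notation "a ⊢ b" := ((a, b) : sequent) : formula_scope.

Local Open Scope formula_scope.

(* An axiom written with a two-sided turnstile contributes two sequents. *)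
Inductive axiom_sequent : sequent -> Prop :=
| ax_refl a : axiom_sequent (a ⊢ a)
| ax_meet_l a b : axiom_sequent (a ⊓ b ⊢ a)
| ax_meet_r a b : axiom_sequent (a ⊓ b ⊢ b)
| ax_join_l a b : axiom_sequent (a ⊢ a ⊔ b)
| ax_join_r a b : axiom_sequent (b ⊢ a ⊔ b)
| ax_meet_id a b : axiom_sequent (a ⊓ b ⊢ (a ⊓ b) ⊓ (a ⊓ b))
| ax_join_id a b : axiom_sequent ((a ⊔ b) ⊔ (a ⊔ b) ⊢ a ⊔ b)
| ax_neg_meet a : axiom_sequent (¬ (a ⊓ a) ⊢ ¬ a)
| ax_opp_join a : axiom_sequent (⌟ a ⊢ ⌟ (a ⊔ a))
| ax_meet_neg a : axiom_sequent (a ⊓ ¬ a ⊢ ⊥)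
| ax_join_opp a : axiom_sequent (⊤ ⊢ a ⊔ ⌟ a)
| ax_neg_neg_1 a b : axiom_sequent (¬ ¬ (a ⊓ b) ⊢ a ⊓ b)
| ax_neg_neg_2 a b : axiom_sequent (a ⊓ b ⊢ ¬ ¬ (a ⊓ b))
| ax_opp_opp_1 a b : axiom_sequent (⌟ ⌟ (a ⊔ b) ⊢ a ⊔ b)
| ax_opp_opp_2 a b : axiom_sequent (a ⊔ b ⊢ ⌟ ⌟ (a ⊔ b))
| ax_meet_join a b : axiom_sequent (a ⊓ a ⊢ a ⊓ (a ⊔ b))
| ax_join_meet a b : axiom_sequent (a ⊔ (a ⊓ b) ⊢ a ⊔ a)
| ax_meet_vee a b : axiom_sequent (a ⊓ a ⊢ a ⊓ (a ∨ b))
| ax_join_wedge a b : axiom_sequent (a ⊔ (a ∧ b) ⊢ a ⊔ a)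
| ax_meet_distr_1 a b c : axiom_sequent (a ⊓ (b ∨ c) ⊢ (a ⊓ b) ∨ (a ⊓ c))
| ax_meet_distr_2 a b c : axiom_sequent ((a ⊓ b) ∨ (a ⊓ c) ⊢ a ⊓ (b ∨ c))
| ax_join_distr_1 a b c : axiom_sequent (a ⊔ (b ∧ c) ⊢ (a ⊔ b) ∧ (a ⊔ c))
| ax_join_distr_2 a b c : axiom_sequent ((a ⊔ b) ∧ (a ⊔ c) ⊢ a ⊔ (b ∧ c))
| ax_bot a : axiom_sequent (⊥ ⊢ a)
| ax_top a : axiom_sequent (a ⊢ ⊤)
| ax_neg_top : axiom_sequent (¬ ⊤ ⊢ ⊥)
| ax_opp_bot : axiom_sequent (⊤ ⊢ ⌟ ⊥)
| ax_neg_bot_1 : axiom_sequent (¬ ⊥ ⊢ ⊤ ⊓ ⊤)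
| ax_neg_bot_2 : axiom_sequent (⊤ ⊓ ⊤ ⊢ ¬ ⊥)
| ax_opp_top_1 : axiom_sequent (⌟ ⊤ ⊢ ⊥ ⊔ ⊥)
| ax_opp_top_2 : axiom_sequent (⊥ ⊔ ⊥ ⊢ ⌟ ⊤)
| ax_mixed_1 a : axiom_sequent ((a ⊔ a) ⊓ (a ⊔ a) ⊢ (a ⊓ a) ⊔ (a ⊓ a))
| ax_mixed_2 a : axiom_sequent ((a ⊓ a) ⊔ (a ⊓ a) ⊢ (a ⊔ a) ⊓ (a ⊔ a))
| ax_ovar_1 p : axiom_sequent (FOVar p ⊓ FOVar p ⊢ FOVar p)
| ax_ovar_2 p : axiom_sequent (FOVar p ⊢ FOVar p ⊓ FOVar p)
| ax_pvar_1 P : axiom_sequent (FPVar P ⊔ FPVar P ⊢ FPVar P)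
| ax_pvar_2 P : axiom_sequent (FPVar P ⊢ FPVar P ⊔ FPVar P).

Inductive axiom : hypersequent -> Prop :=
| ax_sequent s : axiom_sequent s -> axiom [s]
| ax_Sp a : axiom [a ⊢ a ⊓ a; a ⊔ a ⊢ a].

(* [rule ps h]: the hypersequent [h] is inferred from the list of premises
   [ps] by one application of a rule. *)
Inductive rule : list hypersequent -> hypersequent -> Prop :=
| r_meet_r a b c B C :
    rule [B ++ [a ⊢ b] ++ C] (B ++ [a ⊓ c ⊢ b ⊓ c] ++ C)
| r_meet_l a b c B C :
    rule [B ++ [a ⊢ b] ++ C] (B ++ [c ⊓ a ⊢ c ⊓ b] ++ C)
| r_join_r a b c B C :
    rule [B ++ [a ⊢ b] ++ C] (B ++ [a ⊔ c ⊢ b ⊔ c] ++ C)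
| r_join_l a b c B C :
    rule [B ++ [a ⊢ b] ++ C] (B ++ [c ⊔ a ⊢ c ⊔ b] ++ C)
| r_neg a b B C :
    rule [B ++ [a ⊢ b] ++ C] (B ++ [¬ b ⊢ ¬ a] ++ C)
| r_opp a b B C :
    rule [B ++ [a ⊢ b] ++ C] (B ++ [⌟ b ⊢ ⌟ a] ++ C)
| r_trans a b c B C D E :
    rule [B ++ [a ⊢ b] ++ C; D ++ [b ⊢ c] ++ E]
         (B ++ D ++ [a ⊢ c] ++ C ++ E)
| r_order a b B C D E F G H X :
    rule [B ++ [a ⊓ b ⊢ a ⊓ a] ++ C;
          D ++ [a ⊓ a ⊢ a ⊓ b] ++ E;
          F ++ [a ⊔ b ⊢ b ⊔ b] ++ G;
          H ++ [b ⊔ b ⊢ a ⊔ b] ++ X]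
         (B ++ D ++ F ++ H ++ [a ⊢ b] ++ C ++ E ++ G ++ X)
| r_contraction B C D :
    rule [B ++ D ++ D ++ C] (B ++ D ++ C)
| r_exchange B C D E :
    rule [B ++ D ++ E ++ C] (B ++ E ++ D ++ C)
| r_weakening B C :
    rule [B] (B ++ C).

Local Close Scope formula_scope.

Definition derivation (d : list hypersequent) : Prop :=
  forall (d1 d2 : list hypersequent) (h : hypersequent),
    d = d1 ++ h :: d2 ->
    axiom h \/
    exists ps : list hypersequent, rule ps h /\ forall g, In g ps -> In g d1.

Definition provable (h : hypersequent) : Prop :=
  exists d : list hypersequent, derivation (d ++ [h]).

Record valuation (D : dba_sig) : Type := Valuation {
  val_ovar : nat -> D;
  val_pvar : nat -> D;
  val_ovar_meet : forall p : nat, in_meet_part (val_ovar p);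
  val_pvar_join : forall P : nat, in_join_part (val_pvar P)
}.

Fixpoint eval (D : dba_sig) (v : valuation D) (a : formula) : D :=
  match a with
  | FTop => top
  | FBot => bot
  | FOVar p => val_ovar v p
  | FPVar P => val_pvar v P
  | FJoin b c => join (eval v b) (eval v c)
  | FMeet b c => meet (eval v b) (eval v c)
  | FNeg b => neg (eval v b)
  | FOpp b => opp (eval v b)
  end.

Definition satisfies_sequent (D : dba_sig) (v : valuation D) (s : sequent)
    : Prop :=
  sqle (eval v (fst s)) (eval v (snd s)).

Definition satisfies (D : dba_sig) (v : valuation D) (h : hypersequent)
    : Prop :=
  exists s : sequent, In s h /\ satisfies_sequent v s.

Definition true_in (D : dba_sig) (h : hypersequent) : Prop :=
  forall v : valuation D, satisfies v h.

Definition valid (h : hypersequent) : Prop :=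
  forall D : dba_sig, is_pdba D -> true_in D h.

(* Main.v *)
(* Soundness is an induction on derivations.  Everything reduces to two facts
   about a double Boolean algebra: an element of the meet part that is below
   another one for [⊓] is below it for [⊑], and negation reverses the order of
   the Boolean algebra on the meet part; the statements about [⊔] and [⌟]
   follow by duality.  Purity is only needed for the axiom (Sp). *)
From Stdlib Require Import List.
Require Import Defs.
Import ListNotations.

Set Implicit Arguments.
Unset Strict Implicit.
Unset Printing Implicit Defensive.

Definition dual (D : dba_sig) : dba_sig :=
  @DbaSig D (@meet D) (@join D) (@opp D) (@neg D) (@bot D) (@top D).

(** The axioms come in dual pairs, except the last law, which is its own dual with its two sides
    exchanged. *)
Lemma dual_is_dba (D : dba_sig) : is_dba D -> is_dba (dual D).
Proof.
  intros HD; constructor; try apply HD.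
  intros x; symmetry; apply (meet_join_id HD).
Qed.

Section DoubleBooleanAlgebra.

Local Open Scope dba_scope.

Variable D : dba_sig.
Hypothesis HD : is_dba D.

Lemma sqle_dual (x y : D) : @sqle (dual D) x y <-> y ⊑ x.
Proof.
  unfold sqle; simpl.
  rewrite (meet_comm HD x y), (join_comm HD x y); tauto.
Qed.

Lemma sqle_refl (x : D) : x ⊑ x.
Proof. split; reflexivity. Qed.

Lemma sqle_of_eq (x y : D) : x = y -> x ⊑ y.
Proof. intros <-; apply sqle_refl. Qed.

Lemma meet_idr (x y : D) : x ⊓ (y ⊓ y) = x ⊓ y.
Proof.
  now rewrite (meet_comm HD x), (meet_idl HD), (meet_comm HD).
Qed.

Lemma meet_in_meet_part (x y : D) : in_meet_part (x ⊓ y).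
Proof.
  unfold in_meet_part.
  rewrite (meet_comm HD x y) at 2.
  rewrite (meet_assoc HD), <- (meet_assoc HD x y y), meet_idr.
  now rewrite <- (meet_assoc HD), (meet_comm HD y x), (meet_assoc HD),
    (meet_idl HD).
Qed.

Lemma meet_le_trans (x y z : D) :
  x ⊓ y = x ⊓ x -> y ⊓ z = y ⊓ y -> x ⊓ z = x ⊓ x.
Proof.
  intros Hxy Hyz.
  now rewrite <- (meet_idl HD), <- Hxy, <- (meet_assoc HD), Hyz, meet_idr.
Qed.

Lemma meet_le_antisym (x y : D) :
  in_meet_part x -> in_meet_part y -> x ⊑ y -> y ⊑ x -> x = y.
Proof.
  intros Hx Hy [Hxy _] [Hyx _].
  now rewrite <- Hx, <- Hxy, (meet_comm HD), Hyx, Hy.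
Qed.

(** The equation puts [x] in the meet part, which gives the [⊓] half of [⊑]; the [⊔] half is the
    absorption law for [y ⊔ (y ⊓ x)]. *)
Lemma sqle_of_meet_eq (x y : D) : x ⊓ y = x -> x ⊑ y.
Proof.
  intros Hxy; split.
  - rewrite <- Hxy at 2 3; now rewrite meet_in_meet_part.
  - rewrite (join_comm HD), <- Hxy, (meet_comm HD).
    apply (join_meet_absorb HD).
Qed.

Lemma meet_sqle_l (x y : D) : x ⊓ y ⊑ x.
Proof.
  apply sqle_of_meet_eq.
  now rewrite (meet_comm HD), (meet_assoc HD), (meet_idl HD).
Qed.

Lemma meet_sqle_r (x y : D) : x ⊓ y ⊑ y.
Proof. rewrite (meet_comm HD); apply meet_sqle_l. Qed.

Lemma bot_sqle (x : D) : ⊥ ⊑ x.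
Proof. rewrite <- (meet_neg HD x); apply meet_sqle_l. Qed.

Lemma meet_sqle_compat (x y z : D) : x ⊑ y -> x ⊓ z ⊑ y ⊓ z.
Proof.
  intros [Hxy _]; apply sqle_of_meet_eq.
  rewrite (meet_assoc HD), (meet_comm HD (x ⊓ z) y), (meet_assoc HD y x z).
  rewrite (meet_comm HD y x), Hxy, (meet_idl HD).
  now rewrite <- (meet_assoc HD), meet_idr.
Qed.

(** [¬ x ⊓ ¬ x] equals [¬ ¬ ¬ x]. As [¬ x] is also [¬ (x ⊓ x)], and double negation fixes [x ⊓ x],
    this collapses to [¬ x]. *)
Lemma neg_in_meet_part (x : D) : in_meet_part (¬ x).
Proof.
  unfold in_meet_part.
  rewrite <- (neg_neg_meet HD), (neg_meet_id HD).
  now rewrite <- (neg_meet_id HD x), (neg_neg_meet HD).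
Qed.

Lemma neg_sqle_compat (x y : D) : x ⊑ y -> ¬ y ⊑ ¬ x.
Proof.
  intros [Hxy _].
  (* [y ∨ x] equals [y ⊓ y]: expand [y ⊓ (y ∨ x)] by distributivity and by
     absorption. *)
  assert (Hvee : ¬ (¬ y ⊓ ¬ x) = y ⊓ y).
  { rewrite <- (meet_vee_absorb HD y x), (meet_vee_distr HD).
    unfold vee.
    now rewrite (meet_comm HD y x), Hxy, !(neg_meet_id HD). }
  apply sqle_of_meet_eq.
  (* Double negation fixes [¬ y ⊓ ¬ x], so [Hvee] turns it into [¬ (y ⊓ y)], which is [¬ y]. *)
  now rewrite <- (neg_neg_meet HD), Hvee, (neg_meet_id HD).
Qed.

End DoubleBooleanAlgebra.

Section DualLaws.

Local Open Scope dba_scope.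

Variable D : dba_sig.
Hypothesis HD : is_dba D.

Let HD' : is_dba (dual D) := dual_is_dba HD.

Lemma sqle_trans (x y z : D) : x ⊑ y -> y ⊑ z -> x ⊑ z.
Proof.
  intros [Hxy Hxy'] [Hyz Hyz']; split.
  - exact (meet_le_trans HD Hxy Hyz).
  (* For [⊔] the chain is read in the dual algebra, from [z] down to [x]. *)
  - rewrite (join_comm HD) in Hxy', Hyz' |- *.
    exact (@meet_le_trans _ HD' z y x Hyz' Hxy').
Qed.

Lemma join_in_join_part (x y : D) : in_join_part (x ⊔ y).
Proof. exact (meet_in_meet_part HD' x y). Qed.

Lemma join_le_antisym (x y : D) :
  in_join_part x -> in_join_part y -> x ⊑ y -> y ⊑ x -> x = y.
Proof.
  intros Hx Hy Hxy Hyx.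
  apply (@meet_le_antisym _ HD' x y Hx Hy); now apply (sqle_dual HD).
Qed.

Lemma sqle_join_l (x y : D) : x ⊑ x ⊔ y.
Proof. apply (sqle_dual HD), (@meet_sqle_l _ HD'). Qed.

Lemma sqle_join_r (x y : D) : y ⊑ x ⊔ y.
Proof. apply (sqle_dual HD), (@meet_sqle_r _ HD'). Qed.

Lemma sqle_top (x : D) : x ⊑ ⊤.
Proof. apply (sqle_dual HD), (@bot_sqle _ HD'). Qed.

Lemma join_sqle_compat (x y z : D) : x ⊑ y -> x ⊔ z ⊑ y ⊔ z.
Proof.
  intros Hxy; apply (sqle_dual HD), (@meet_sqle_compat _ HD').
  now apply (sqle_dual HD).
Qed.

Lemma opp_sqle_compat (x y : D) : x ⊑ y -> ⌟ y ⊑ ⌟ x.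
Proof.
  intros Hxy; apply (sqle_dual HD), (@neg_sqle_compat _ HD').
  now apply (sqle_dual HD).
Qed.

(** Meets lie in the meet part and joins in the join part, where [⊑] is antisymmetric; so the
    premises pair up into the two equations that define [x ⊑ y]. *)
Lemma sqle_of_order_premises (x y : D) :
  x ⊓ y ⊑ x ⊓ x -> x ⊓ x ⊑ x ⊓ y -> x ⊔ y ⊑ y ⊔ y -> y ⊔ y ⊑ x ⊔ y ->
  x ⊑ y.
Proof.
  intros; split.
  - now apply (meet_le_antisym HD); try apply (meet_in_meet_part HD).
  - now apply join_le_antisym; try apply join_in_join_part.
Qed.

End DualLaws.

Lemma axiom_sequent_sound (D : dba_sig) (v : valuation D) (s : sequent) :
  is_dba D -> axiom_sequent s -> satisfies_sequent v s.
Proof.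
  intros HD Hs; unfold satisfies_sequent.
  destruct Hs; simpl;
    solve
      [ apply (meet_sqle_l HD) | apply (meet_sqle_r HD)
      | apply (sqle_join_l HD) | apply (sqle_join_r HD)
      | apply (bot_sqle HD) | apply (sqle_top HD)
      (* Every axiom other than the projections, injections and bounds holds as an equation;
         backtracking picks the direction in which the law is stated. *)
      | apply sqle_of_eq; (idtac + symmetry);
        first
          [ reflexivity
          | apply (meet_in_meet_part HD) | apply (join_in_join_part HD)
          | apply (val_ovar_meet v) | apply (val_pvar_join v)
          | apply HD ] ].
Qed.

Lemma axiom_sound (D : dba_sig) (v : valuation D) (h : hypersequent) :
  is_pdba D -> axiom h -> satisfies v h.
Proof.
  intros [HD Hpure] [s Hs | a].
  - exists s; split; [now left | now apply axiom_sequent_sound].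
  (* The part that contains the value of [a] decides which component of (Sp) is satisfied. *)
  - destruct (Hpure (eval v a)) as [Ha | Ha];
      [exists (a, FMeet a a) | exists (FJoin a a, a)];
      (split; [simpl; tauto |]); apply sqle_of_eq; [symmetry |]; exact Ha.
Qed.

(** Reading concatenation as disjunction makes side hypersequents propositional atoms, so that
    [tauto] can handle the contexts of the rules. *)
Lemma satisfies_app (D : dba_sig) (v : valuation D) (B C : hypersequent) :
  satisfies v (B ++ C) <-> satisfies v B \/ satisfies v C.
Proof.
  unfold satisfies; rewrite <- !Exists_exists; apply Exists_app.
Qed.

Lemma satisfies_sequent1 (D : dba_sig) (v : valuation D) (a b : formula) :
  satisfies v [(a, b)] <-> sqle (eval v a) (eval v b).
Proof.
  unfold satisfies; rewrite <- Exists_exists, Exists_cons, Exists_nil.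
  unfold satisfies_sequent; simpl; tauto.
Qed.

Lemma rule_sound (D : dba_sig) (v : valuation D) (ps : list hypersequent)
    (h : hypersequent) :
  is_dba D -> rule ps h -> Forall (satisfies v) ps -> satisfies v h.
Proof.
  intros HD Hr.
  destruct Hr; rewrite ?Forall_cons_iff, !satisfies_app, ?satisfies_sequent1;
    simpl.
  - pose proof (meet_sqle_compat HD (x := eval v a) (y := eval v b)
      (eval v c)); tauto.
  - rewrite !(meet_comm HD (eval v c)).
    pose proof (meet_sqle_compat HD (x := eval v a) (y := eval v b)
      (eval v c)); tauto.
  - pose proof (join_sqle_compat HD (x := eval v a) (y := eval v b)
      (eval v c)); tauto.
  - rewrite !(join_comm HD (eval v c)).
    pose proof (join_sqle_compat HD (x := eval v a) (y := eval v b)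
      (eval v c)); tauto.
  - pose proof (neg_sqle_compat HD (x := eval v a) (y := eval v b)); tauto.
  - pose proof (opp_sqle_compat HD (x := eval v a) (y := eval v b)); tauto.
  - pose proof (sqle_trans HD (x := eval v a) (y := eval v b)
      (z := eval v c)); tauto.
  - pose proof (sqle_of_order_premises HD (x := eval v a) (y := eval v b));
      tauto.
  (* The external rules involve no algebra: they are tautologies about disjunctions. *)
  - tauto.
  - tauto.
  - tauto.
Qed.

(** Induction from the right end works because a prefix of a derivation is a derivation, and the
    premises of the last member lie in the prefix before it. *)
Lemma derivation_ind (P : hypersequent -> Prop) :
  (forall h, axiom h -> P h) ->
  (forall ps h, rule ps h -> Forall P ps -> P h) ->
  forall d, derivation d -> Forall P d.
Proof.
  intros Hax Hrule d; induction d as [| h d IH] using rev_ind; intros Hd.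
  - constructor.
  - assert (HPd : Forall P d).
    { apply IH; intros d1 d2 g ->.
      apply (Hd d1 (d2 ++ [h])); now rewrite <- app_assoc. }
    apply Forall_app; split; [exact HPd |].
    repeat constructor.
    destruct (Hd d [] h eq_refl) as [Hh | [ps [Hps Hin]]]; [now apply Hax |].
    apply (Hrule ps h Hps), Forall_forall; intros g Hg.
    rewrite Forall_forall in HPd; auto.
Qed.

Theorem theorem35 (h : hypersequent) : provable h -> valid h.
Proof.
  intros [d Hd] D HD v.
  (* Each rule preserves satisfaction by a single valuation, so [v] stays fixed along the whole
     derivation. *)
  assert (Hall : Forall (satisfies v) (d ++ [h])).
  { apply derivation_ind; [| | exact Hd].
    - intros g; now apply axiom_sound.
    - intros ps g; apply rule_sound, HD. }
  apply Forall_app in Hall; destruct Hall as [_ Hh].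
  now inversion Hh.
Qed.
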